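(* Let $G=(U,V,E)$ be a complete bipartite graph with edge labels in $\{\pm1\}$, $m=|U|$, $n=|V|$, bi-adjacency matrix $\mathbf{B}\in\{\pm1\}^{m\times n}$, and let $\delta\in(0,1)$. Run the following procedure: set $k=2^{3}\delta^{-1}$, $\epsilon=2^{-6}\delta^{2}$, $r=2^{8}\delta^{-2}-1$; compute the rank-$r$ truncated SVD $\widetilde{\mathbf{B}}$ of $\mathbf{B}$; run BiLinearLowRankSolver on input $\widetilde{\mathbf{B}}$ with accuracy $\epsilon$ over $\mathcal{X}=\{\mathbf{X}\in\{0,1\}^{m\times k}:\|\mathbf{X}\|_{\infty,1}=1\}$ and $\mathcal{Y}=\{\mathbf{Y}\in\{0,1\}^{n\times k}:\|\mathbf{Y}\|_{\infty,1}=1\}$, using as both oracles the row-wise argmax rule (given $\mathbf{L}$, put a single $1$ in each row $i$ at a column $j_i\in\arg\max_j L_{ij}$). The output pair $(\widetilde{\mathbf{X}},\widetilde{\mathbf{Y}})$ defines a clustering $\widetilde{\mathcal{C}}$ of $U\cup V$ into at most $2^3\delta^{-1}$ clusters (vertex $i\in U$ goes to cluster $j$ iff $\widetilde X_{ij}=1$, similarly for $V$). Then $$\mathrm{Agree}(\widetilde{\mathcal{C}})\ge(1-\delta)\,\mathrm{Agree}(\mathcal{C}_\star),$$ where $\mathcal{C}_\star$ is an optimal clustering of $U\cup V$ with no constraint on the number of clusters, and the running time is $2^{O(\delta^{-3}\log\delta^{-3})}\cdot\delta^{-2}\cdot(m+n)+\mathrm{T}_{\mathrm{SVD}}(\delt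a^{-2})$.
   Context: For a clustering $\mathcal{C}$ of $U\cup V$, $\mathrm{Agree}(\mathcal{C})$ is the number of $+1$ edges with both endpoints in the same cluster plus the number of $-1$ edges with endpoints in different clusters. $\|\mathbf{X}\|_{\infty,1}$ is the maximum row $\ell_1$-norm. BiLinearLowRankSolver (input $\widetilde{\mathbf{A}}$ of rank $r$, accuracy $\epsilon$, oracles $\mathrm{P}_{\mathcal{X}},\mathrm{P}_{\mathcal{Y}}$ returning maximizers of $\operatorname{Tr}(\mathbf{X}^\top\mathbf{L})$ over $\mathcal{X}$ and of $\operatorname{Tr}(\mathbf{R}^\top\mathbf{Y})$ over $\mathcal{Y}$): compute the truncated SVD $\widetilde{\mathbf{A}}=\widetilde{\mathbf{U}}\widetilde{\mathbf{\Sigma}}\widetilde{\mathbf{V}}^\top$, $\widetilde{\mathbf{\Sigma}}\in\mathbb{R}^{r\times r}$; fix an $\epsilon$-net in $\ell_2$ of the unit $\ell_2$-ball of $\mathbb{R}^r$ of cardinality at most $(2\sqrt r/\epsilon)^r$; for each $r\times k$ matrix $\mathbf{C}$ with all columns in the net, set $\mathbf{L}=\widetilde{\mathbf{U}}\widetilde{\mathbf{\Sigma}}\mathbf{C}$, $\mathbf{X}=\mathrm{P}_{\mathcal{X}}(\mathbf{L})$, $\mathbf{R}=\mathbf{X}^\top\widetilde{\mathbf{A}}$ (transposed as needed), $\mathbf{Y}=\mathrm{P}_{\mathcal{Y}}(\mathbf{R})$, record $(\mathbf{X},\mathbf{Y})$; output the recorded pair maximizing $\operatorname{Tr}(\mathbf{X}^\top\widetilde{\mathbf{A}}\mathbf{Y})$.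 $\mathrm{T}_{\mathrm{SVD}}(s)$ denotes the time to compute a rank-$s$ truncated SVD of $\mathbf{B}$.
   Formalization: k and r are rounded down to integers, since 2^3/δ and 2^8/δ^2−1 need not be integral, and the SVD term charged is T_SVD(r) at the rank r that the procedure actually computes, instead of T_SVD(δ^-2). *)

(* Defs.v *)
From HB Require Import structures.
From mathcomp Require Import all_boot all_order all_algebra.
From mathcomp Require Import all_classical all_reals all_analysis.

Set Implicit Arguments.
Unset Strict Implicit.
Unset Printing Implicit Defensive.

Import Order.TTheory GRing.Theory Num.Theory.
Import numFieldNormedType.Exports.

Local Open Scope ring_scope.

(* Bipartite correlation clustering.  The two sides of the graph are 'I_m and
   'I_n, the edge (u, v) carries the label B u v, and a clustering is a
   partition of the disjoint sum 'I_m + 'I_n. *)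

Section Clustering.
Variables (R : realType) (m n : nat).
Implicit Types (B : 'M[R]_(m, n)) (C : {set {set ('I_m + 'I_n)%type}}).

Definition sign_matrix B : Prop := forall u v, B u v = 1 \/ B u v = -1.

Definition clustering C : bool := finset.partition C [set: ('I_m + 'I_n)%type].

Definition same_cluster C (u : 'I_m) (v : 'I_n) : bool :=
  [exists K in C, (inl u \in K) && (inr v \in K)].

Definition agree B C : nat :=
  #|[set e : 'I_m * 'I_n | (B e.1 e.2 == 1) && same_cluster C e.1 e.2]|
  + #|[set e : 'I_m * 'I_n | (B e.1 e.2 == -1) && ~~ same_cluster C e.1 e.2]|.

Definition optimal_clustering B C : Prop :=
  clustering C /\ forall C', clustering C' -> (agree B C' <= agree B C)%N.

Definition cluster_of k (X : 'M[R]_(m, k)) (Y : 'M[R]_(n, k)) (j : 'I_k) :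
    {set ('I_m + 'I_n)%type} :=
  [set z | match z with inl u => X u j == 1 | inr v => Y v j == 1 end].

Definition clustering_of k (X : 'M[R]_(m, k)) (Y : 'M[R]_(n, k)) :
    {set {set ('I_m + 'I_n)%type}} :=
  ([set cluster_of X Y j | j : 'I_k] :\ finset.set0)%SET.

End Clustering.

Section Norms.
Variable R : realType.

Definition norm_inf1 p k (X : 'M[R]_(p, k)) : R :=
  \big[Num.max/0]_(i < p) \sum_(j < k) `|X i j|.

(* The sets written $\mathcal X$ (p = m) and $\mathcal Y$ (p = n). *)
Definition feasible p k (X : 'M[R]_(p, k)) : Prop :=
  (forall i j, X i j = 0 \/ X i j = 1) /\ norm_inf1 X = 1.

(* The norm `|x| of the library is the sup norm on matrices. *)
Definition l2norm s (x : 'cV[R]_s) : R := Num.sqrt (\sum_(i < s) x i 0 ^+ 2).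

Definition ball_net (eps : R) s (N : seq 'cV[R]_s) : Prop :=
  (forall x, x \in N -> l2norm x <= 1) /\
  (forall x, l2norm x <= 1 -> exists2 y, y \in N & l2norm (x - y) <= eps).

End Norms.

(* A (truncated) singular value decomposition U * diag(S) * V^T. *)
Record svd_factors (R : realType) (m n : nat) := SvdFactors {
  svd_rank : nat;
  svd_U : 'M[R]_(m, svd_rank);
  svd_S : 'rV[R]_svd_rank;
  svd_V : 'M[R]_(n, svd_rank) }.

Section Svd.
Variables (R : realType) (m n : nat).
Implicit Types (A : 'M[R]_(m, n)) (F G : svd_factors R m n).

(* Compact decomposition: the singular values kept are the positive ones, so
   that svd_rank G is the rank of A. *)
Definition is_svd A G : Prop :=
  [/\ (svd_U G)^T *m svd_U G = 1%:M,
      (svd_V G)^T *m svd_V G = 1%:M,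
      forall i, 0 < svd_S G 0 i,
      forall i j : 'I_(svd_rank G), (i <= j)%N -> svd_S G 0 j <= svd_S G 0 i
    & A = svd_U G *m diag_mx (svd_S G) *m (svd_V G)^T].

Definition svd_trunc (r : nat) G : svd_factors R m n :=
  let w := widen_ord (geq_minr r (svd_rank G)) in
  SvdFactors (colsub w (svd_U G)) (colsub w (svd_S G)) (colsub w (svd_V G)).

(* All r leading singular triples of A, or all of them when A has rank < r. *)
Definition truncated_svd (r : nat) A F : Prop :=
  exists2 G, is_svd A G & F = svd_trunc r G.

End Svd.

(* Cost model: unit-cost real random access machine.  A program returns its
   result together with the number of elementary steps it performed: reads of
   an array entry, arithmetic operations, comparisons, writes of an array
   entry, and loop iterations each cost 1. *)

Record timed (A : Type) := Timed { result : A; cost : nat }.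

Definition tret A (a : A) : timed A := Timed a 0.
Definition tstep A (a : A) : timed A := Timed a 1.
Definition tbind A A' (x : timed A) (f : A -> timed A') : timed A' :=
  Timed (result (f (result x))) (cost x + cost (f (result x)))%N.

Notation "'let!' x ':=' c1 'in' c2" := (tbind c1 (fun x => c2))
  (at level 200, x name, c1 at level 200, c2 at level 200,
   format "'[v' 'let!'  x  ':='  c1  'in' '/' c2 ']'").

Fixpoint tfold T A (f : A -> T -> timed A) (z : A) (s : seq T) : timed A :=
  if s is x :: s' then
    let! u := tstep tt in let! z' := f z x in tfold f z' s'
  else tret z.

Fixpoint tmap T A (f : T -> timed A) (s : seq T) : timed (seq A) :=
  if s is x :: s' then
    let! u := tstep tt in
    let! y := f x in let! ys := tmap f s' in tret (y :: ys)
  else tret [::].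

(* Scan s for an element with the largest key.  Ties are resolved by an
   arbitrary policy: tie x says whether x replaces an earlier element with an
   equal key, and every maximizer is selected by some policy. *)
Definition tscan_max (R : realType) T (key : T -> timed R) (tie : T -> bool)
    (s : seq T) : timed (option T) :=
  tfold (fun best x =>
    if best is Some b then
      let! kb := key b in
      let! kx := key x in
      let! better := tstep ((kb < kx) || ((kb == kx) && tie x)) in
      tret (if better then Some x else best)
    else tret (Some x)) None s.

Section Programs.
Variable R : realType.

Definition tadd (x y : R) : timed R := tstep (x + y).
Definition tmul (x y : R) : timed R := tstep (x * y).
Definition tget p q (A : 'M[R]_(p, q)) i j : timed R := tstep (A i j).

Definition tsum p (f : 'I_p -> timed R) : timed R :=
  tfold (fun acc i => let! x := f i in tadd acc x) 0 (enum 'I_p).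

(* Each entry is charged the cost of its evaluation, one loop iteration and
   one write; likewise for each loop iteration over the rows. *)
Definition tmx p q (f : 'I_p -> 'I_q -> timed R) : timed 'M[R]_(p, q) :=
  Timed (\matrix_(i, j) result (f i j))
        (\sum_(i < p) (\sum_(j < q) (cost (f i j)).+2).+1)%N.

Definition tarray p T (f : 'I_p -> timed T) : timed ('I_p -> T) :=
  Timed (fun i => result (f i)) (\sum_(i < p) (cost (f i)).+2)%N.

Definition tmulmx p q l (A : 'M[R]_(p, q)) (A' : 'M[R]_(q, l)) :
    timed 'M[R]_(p, l) :=
  tmx (fun i j => tsum (fun h =>
    let! a := tget A i h in let! b := tget A' h j in tmul a b)).

Definition ttrmx p q (A : 'M[R]_(p, q)) : timed 'M[R]_(q, p) :=
  tmx (fun i j => tget A j i).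

(* diag(d) *m A *)
Definition tdiagmul p q (d : 'rV[R]_p) (A : 'M[R]_(p, q)) :
    timed 'M[R]_(p, q) :=
  tmx (fun i j => let! a := tget d 0 i in let! b := tget A i j in tmul a b).

(* Tr(A^T *m A') *)
Definition tdot p q (A A' : 'M[R]_(p, q)) : timed R :=
  tsum (fun i => tsum (fun j =>
    let! a := tget A i j in let! b := tget A' i j in tmul a b)).

(* The row-wise argmax oracle; tie L i j is the tie-breaking policy used for
   row i of L. *)
Definition row_argmax p k (tie : 'M[R]_(p, k) -> 'I_p -> 'I_k -> bool)
    (L : 'M[R]_(p, k)) : timed 'M[R]_(p, k) :=
  let! best := tarray (fun i => tscan_max (tget L i) (tie L i) (enum 'I_k)) in
  tmx (fun i j => let! b := tstep (best i) in tstep (b == Some j)%:R).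

(* One round, for the matrix with columns N`_(c j).  With F a decomposition of
   the input matrix A, L = U * diag(S) * C, and A^T *m X is evaluated as
   V * (diag(S) * (U^T * X)); the value recorded is Tr(X^T * A * Y). *)
Definition solver_round m n k (F : svd_factors R m n)
    (N : seq 'cV[R]_(svd_rank F))
    (PX : 'M[R]_(m, k) -> timed 'M[R]_(m, k))
    (PY : 'M[R]_(n, k) -> timed 'M[R]_(n, k))
    (c : {ffun 'I_k -> 'I_(size N)}) :
    timed (R * ('M[R]_(m, k) * 'M[R]_(n, k))) :=
  let! C := tmx (fun l j => tstep ((nth 0 N (c j)) l 0)) in
  let! SC := tdiagmul (svd_S F) C in
  let! L := tmulmx (svd_U F) SC in
  let! X := PX L in
  let! Ut := ttrmx (svd_U F) in
  let! UX := tmulmx Ut X in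
  let! SUX := tdiagmul (svd_S F) UX in
  let! Rt := tmulmx (svd_V F) SUX in
  let! Y := PY Rt in
  let! v := tdot Rt Y in
  tret (v, (X, Y)).

(* BiLinearLowRankSolver.  The input matrix is given by its decomposition F,
   so no second decomposition is computed.  The final tie-breaking policy is
   arbitrary; None is returned when nothing was recorded (no net point). *)
Definition bilinear_low_rank_solver m n k (F : svd_factors R m n)
    (N : seq 'cV[R]_(svd_rank F))
    (PX : 'M[R]_(m, k) -> timed 'M[R]_(m, k))
    (PY : 'M[R]_(n, k) -> timed 'M[R]_(n, k))
    (tie : R * ('M[R]_(m, k) * 'M[R]_(n, k)) -> bool) :
    timed (option ('M[R]_(m, k) * 'M[R]_(n, k))) :=
  let! recorded := tmap (solver_round PX PY)
                        (enum {ffun 'I_k -> 'I_(size N)}) in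
  let! best := tscan_max (fun p => tstep p.1) tie recorded in
  tret (omap snd best).

(* The parameters k, epsilon and r; k and r are rounded down to integers. *)
Definition bcc_k (delta : R) : nat := Num.truncn (2 ^+ 3 / delta).
Definition bcc_eps (delta : R) : R := delta ^+ 2 / 2 ^+ 6.
Definition bcc_r (delta : R) : nat := Num.truncn (2 ^+ 8 / delta ^+ 2 - 1).

(* svd is the routine computing truncated decompositions of the bi-adjacency
   matrix, and net s is the net fixed in dimension s. *)
Definition bcc_procedure m n (delta : R)
    (svd : nat -> timed (svd_factors R m n))
    (net : forall s : nat, seq 'cV[R]_s)
    (tieX : 'M[R]_(m, bcc_k delta) -> 'I_m -> 'I_(bcc_k delta) -> bool)
    (tieY : 'M[R]_(n, bcc_k delta) -> 'I_n -> 'I_(bcc_k delta) -> bool)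
    (tie : R * ('M[R]_(m, bcc_k delta) * 'M[R]_(n, bcc_k delta)) -> bool) :
    timed (option ('M[R]_(m, bcc_k delta) * 'M[R]_(n, bcc_k delta))) :=
  let! F := svd (bcc_r delta) in
  bilinear_low_rank_solver (net (svd_rank F))
    (row_argmax tieX) (row_argmax tieY) tie.

End Programs.

Arguments bcc_procedure {R m n} delta svd net tieX tieY tie.

(* Main.v *)
Require Import Defs.
From mathcomp Require Import all_boot all_order all_algebra.
From mathcomp Require Import all_classical all_reals all_analysis.
From mathcomp Require Import zify ring lra.
Import Order.TTheory GRing.Theory Num.Theory.
Import numFieldNormedType.Exports.
Local Open Scope ring_scope.

(* Since the all-in-one and the two-cluster {U, V} clusterings together agree
   with every edge, the optimum is at least mn/2, so an additive loss of
   (delta/2) mn is affordable.  With N^- the number of -1 edges,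
   Agree = N^- + Tr(X^T B Y).  Three losses are incurred:
   - at most mn/(k-1) <= (delta/6) mn for merging the optimal clustering into
     k clusters;
   - at most (delta/15) mn, twice, for replacing B by its truncation, because
     (r+1) sigma_(r+1)^2 <= ||B||_F^2 = mn;
   - at most (delta/22) mn, twice, for replacing the columns of
     V^T Y / sqrt n, which lie in the unit ball, by net points; the factor
     sqrt n is harmless since argmax is invariant under scaling.  The bounds
     are all Cauchy-Schwarz for the Frobenius inner product. *)

Lemma result_tsum (R : realType) p (f : 'I_p -> timed R) :
  result (tsum f) = \sum_(i < p) result (f i).
Proof.
rewrite /tsum -big_enum /=.
suff sumE s z : result (tfold (fun acc i => let! x := f i in tadd acc x) z s)
    = z + \sum_(i <- s) result (f i) by rewrite sumE add0r.
elim: s z => [|i s IH] z /=; first by rewrite big_nil addr0.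
by rewrite IH big_cons addrA.
Qed.

Lemma cost_tsum (R : realType) p c (f : 'I_p -> timed R) :
  (forall i, cost (f i) = c) -> cost (tsum f) = (p * c.+2)%N.
Proof.
move=> fc; rewrite /tsum -[in RHS](size_enum_ord p).
elim: (enum _) (0 : R) => [//|i s IH] z /=.
by rewrite IH fc /=; lia.
Qed.

Lemma cost_tmx (R : realType) p q c (f : 'I_p -> 'I_q -> timed R) :
  (forall i j, cost (f i j) = c) -> cost (tmx f) = (p * (q * c.+2).+1)%N.
Proof.
move=> fc /=; under eq_bigr => i _ do under eq_bigr => j _ do rewrite fc.
by under eq_bigr => i _ do rewrite sum_nat_const card_ord;
   rewrite sum_nat_const card_ord.
Qed.

Lemma result_tmulmx (R : realType) p q l (A : 'M[R]_(p, q)) (A' : 'M[R]_(q, l)) :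
  result (tmulmx A A') = A *m A'.
Proof. by apply/matrixP => i j; rewrite !mxE result_tsum. Qed.

Lemma cost_tmulmx (R : realType) p q l (A : 'M[R]_(p, q)) (A' : 'M[R]_(q, l)) :
  cost (tmulmx A A') = (p * (l * (q * 5).+2).+1)%N.
Proof. by apply: cost_tmx => i j; apply: cost_tsum. Qed.

Lemma result_ttrmx (R : realType) p q (A : 'M[R]_(p, q)) :
  result (ttrmx A) = A^T.
Proof. by apply/matrixP => i j; rewrite !mxE. Qed.

Lemma cost_ttrmx (R : realType) p q (A : 'M[R]_(p, q)) :
  cost (ttrmx A) = (q * (p * 3).+1)%N.
Proof. exact: cost_tmx. Qed.

Lemma result_tdiagmul (R : realType) p q (d : 'rV[R]_p) (A : 'M[R]_(p, q)) :
  result (tdiagmul d A) = diag_mx d *m A.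
Proof. by apply/matrixP => i j; rewrite mul_diag_mx !mxE. Qed.

Lemma cost_tdiagmul (R : realType) p q (d : 'rV[R]_p) (A : 'M[R]_(p, q)) :
  cost (tdiagmul d A) = (p * (q * 5).+1)%N.
Proof. exact: cost_tmx. Qed.

Definition frob {R : realType} {p q} (A A' : 'M[R]_(p, q)) : R :=
  \sum_i \sum_j A i j * A' i j.

Lemma result_tdot (R : realType) p q (A A' : 'M[R]_(p, q)) :
  result (tdot A A') = frob A A'.
Proof.
by rewrite result_tsum; apply: eq_bigr => i _; rewrite result_tsum.
Qed.

Lemma cost_tdot (R : realType) p q (A A' : 'M[R]_(p, q)) :
  cost (tdot A A') = (p * (q * 5).+2)%N.
Proof. by apply: cost_tsum => i; apply: cost_tsum. Qed.

Lemma tscan_maxP (R : realType) (T : eqType) (key : T -> timed R) tie s :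
  s != [::] ->
  exists b, [/\ result (tscan_max key tie s) = Some b, b \in s
    & forall x, x \in s -> result (key x) <= result (key b)].
Proof.
case: s => [//|x0 s] _; rewrite /tscan_max /=.
elim: s x0 => [|y s IH] x0 /=.
  by exists x0; split=> // [|x]; rewrite ?mem_head // inE => /eqP->.
set key_lt := (_ < _); set best := if _ then _ else _.
have [z [-> zxy zmax]] : exists z, [/\ best = Some z, z \in [:: x0; y]
    & forall x, x \in [:: x0; y] -> result (key x) <= result (key z)].
  rewrite /best /key_lt; case: ltgtP => /= [lt|gt|eq].
  - exists y; split=> // [|x]; first by rewrite !inE eqxx orbT.
    by rewrite !inE => /orP[] /eqP-> //; apply: ltW.
  - exists x0; split=> // [|x]; first by rewrite !inE eqxx.
    by rewrite !inE => /orP[] /eqP-> //; apply: ltW.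
  - case: (tie y); [exists y|exists x0];
      (split=> // [|x]; rewrite !inE ?eqxx ?orbT // => /orP[] /eqP->);
      by rewrite ?eq.
have [b [-> bs bmax]] := IH z; exists b; split=> // [|x].
  move: bs; rewrite !inE => /orP[/eqP->|->]; last by rewrite !orbT.
  by move: zxy; rewrite !inE orbA => ->.
rewrite !inE orbA => /orP[xs|xs]; last by rewrite bmax // inE xs orbT.
apply: le_trans (bmax z (mem_head _ _)); apply: zmax.
by rewrite !inE.
Qed.

Lemma cost_tscan_max (R : realType) T (key : T -> timed R) tie s :
  (forall x, cost (key x) <= 1)%N ->
  (cost (tscan_max key tie s) <= size s * 4)%N.
Proof.
move=> key1; rewrite /tscan_max; elim: s (None : option T) => [//|x s IH] b /=.
rewrite mulSn addSn -addnS; case: b => [b|] /=; last first.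
  by have := IH (Some x); lia.
have := key1 b; have := key1 x; set b' := if _ then _ else _.
by have := IH b'; lia.
Qed.

Lemma result_tmap T A (f : T -> timed A) s :
  result (tmap f s) = [seq result (f x) | x <- s].
Proof. by elim: s => //= x s ->. Qed.

Lemma cost_tmap T A (f : T -> timed A) c s :
  (forall x, cost (f x) <= c)%N -> (cost (tmap f s) <= size s * c.+1)%N.
Proof.
move=> fc; elim: s => [//|x s IH] /=.
by rewrite addn0 mulSn; have := fc x; lia.
Qed.

Definition assign_mx {R : realType} {p k} (f : 'I_p -> 'I_k) : 'M[R]_(p, k) :=
  \matrix_(i, j) (f i == j)%:R.

Lemma row_argmaxP (R : realType) p k tie (L : 'M[R]_(p, k)) : (0 < k)%N ->
  exists2 f, result (row_argmax tie L) = assign_mx f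
    & forall i j, L i j <= L i (f i).
Proof.
move=> k0.
have /choice[f fP] i : exists b,
    result (tscan_max (tget L i) (tie L i) (enum 'I_k)) = Some b
    /\ forall j, L i j <= L i b.
  have [|b [-> _ bmax]] := @tscan_maxP R _ (tget L i) (tie L i) (enum 'I_k).
    by rewrite -size_eq0 size_enum_ord -lt0n.
  by exists b; split=> // j; apply: bmax; rewrite mem_enum.
exists f; last by move=> i; case: (fP i).
by apply/matrixP => i j; rewrite !mxE /= (fP i).1.
Qed.

Lemma cost_row_argmax (R : realType) p k tie (L : 'M[R]_(p, k)) :
  (cost (row_argmax tie L) <= p * (8 * k + 3))%N.
Proof.
rewrite /row_argmax /=.
under [X in (_ + X)%N]eq_bigr => i _ do rewrite sum_nat_const card_ord.
rewrite sum_nat_const card_ord.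
have -> : (p * (8 * k + 3) = p * (k * 4 + 2) + p * (k * 4).+1)%N by lia.
rewrite leq_add2r -[X in (X * (k * 4 + 2))%N]card_ord -sum_nat_const.
apply: leq_sum => i _; rewrite -addn2 leq_add2r.
by have := @cost_tscan_max R _ (tget L i) (tie L i) (enum 'I_k) (fun=> leqnn 1);
  rewrite size_enum_ord.
Qed.

Lemma frobE (R : realType) p q (A A' : 'M[R]_(p, q)) :
  frob A A' = \tr (A^T *m A').
Proof.
rewrite /frob exchange_big; apply: eq_bigr => j _.
by rewrite mxE; apply: eq_bigr => i _; rewrite mxE.
Qed.

Lemma frob_mulmxl (R : realType) p q l (A : 'M[R]_(p, q)) (B : 'M[R]_(q, l))
    (C : 'M[R]_(p, l)) :
  frob (A *m B) C = frob B (A^T *m C).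
Proof. by rewrite !frobE trmx_mul mulmxA. Qed.

Lemma frobC (R : realType) p q (A A' : 'M[R]_(p, q)) : frob A A' = frob A' A.
Proof. by apply: eq_bigr => i _; apply: eq_bigr => j _; rewrite mulrC. Qed.

Lemma frobDr (R : realType) p q (A A' B : 'M[R]_(p, q)) :
  frob B (A + A') = frob B A + frob B A'.
Proof. by rewrite !frobE mulmxDr mxtraceD. Qed.

Lemma frobZr (R : realType) p q a (A B : 'M[R]_(p, q)) :
  frob B (a *: A) = a * frob B A.
Proof. by rewrite !frobE -scalemxAr mxtraceZ. Qed.

Lemma frobZl (R : realType) p q a (A B : 'M[R]_(p, q)) :
  frob (a *: A) B = a * frob A B.
Proof. by rewrite frobC frobZr frobC. Qed.

Lemma frobDl (R : realType) p q (A A' B : 'M[R]_(p, q)) :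
  frob (A + A') B = frob A B + frob A' B.
Proof. by rewrite frobC frobDr !(frobC _ _ _ B). Qed.

Lemma frob_ge0 (R : realType) p q (A : 'M[R]_(p, q)) : 0 <= frob A A.
Proof.
by apply: sumr_ge0 => i _; apply: sumr_ge0 => j _; rewrite -expr2 sqr_ge0.
Qed.

Lemma frob_eq0 (R : realType) p q (A : 'M[R]_(p, q)) : frob A A = 0 -> A = 0.
Proof.
move=> A0; apply/matrixP => i j; rewrite mxE; apply/eqP.
have sq_ge0 k l : true -> 0 <= A k l * A k l by rewrite -expr2 sqr_ge0.
have /psumr_eq0P/(_ A0) rows0 k : true -> 0 <= \sum_l A k l * A k l.
  by move=> _; apply: sumr_ge0 => l; apply: sq_ge0.
have /psumr_eq0P/(_ (rows0 i isT))/(_ j isT)/eqP l := sq_ge0 i.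
by move: l; rewrite mulf_eq0 orbb.
Qed.

Lemma frob_cauchy (R : realType) p q (A B : 'M[R]_(p, q)) :
  frob A B ^+ 2 <= frob A A * frob B B.
Proof.
have [B0|Bn0] := eqVneq (frob B B) 0.
  have -> : B = 0 *: B by rewrite (frob_eq0 _ _ _ _ B0) scale0r.
  by rewrite !frobZr !mul0r expr0n mulr0.
have Bgt0 : 0 < frob B B by rewrite lt_neqAle eq_sym Bn0 frob_ge0.
have := frob_ge0 R _ _ (frob B B *: A + (- frob A B) *: B).
rewrite !(frobDr, frobDl, frobZr, frobZl).
rewrite (frobC _ _ _ B A) => quad_ge0.
rewrite -subr_ge0 -(pmulr_rge0 _ Bgt0); apply: le_trans quad_ge0 _.
by rewrite le_eqVlt; apply/orP; left; apply/eqP; ring.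
Qed.

Lemma frob_bessel (R : realType) p s q (U : 'M[R]_(p, s)) (A : 'M[R]_(p, q)) :
  U^T *m U = 1%:M -> frob (U^T *m A) (U^T *m A) <= frob A A.
Proof.
move=> UU; set Z := U^T *m A.
have UZA : frob (U *m Z) A = frob Z Z by rewrite frob_mulmxl.
have UZUZ : frob (U *m Z) (U *m Z) = frob Z Z.
  by rewrite frob_mulmxl mulmxA UU mul1mx.
have := frob_ge0 R _ _ (A + (-1) *: (U *m Z)).
rewrite !(frobDr, frobDl, frobZr, frobZl).
rewrite (frobC _ _ _ A (U *m _)) UZA UZUZ.
by lra.
Qed.

Lemma frob_diag_mx (R : realType) s q (d : 'rV[R]_s) tau (A : 'M[R]_(s, q)) :
  (forall i, d 0 i ^+ 2 <= tau) ->
  frob (diag_mx d *m A) (diag_mx d *m A) <= tau * frob A A.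
Proof.
move=> d_le; rewrite mulr_sumr; apply: ler_sum => i _.
rewrite mulr_sumr; apply: ler_sum => j _; rewrite mul_diag_mx mxE mulrACA.
by rewrite -!expr2 ler_wpM2r ?sqr_ge0 // expr2 -expr2.
Qed.

Lemma frob_svd (R : realType) m n s (U : 'M[R]_(m, s)) (V : 'M[R]_(n, s)) d :
  U^T *m U = 1%:M -> V^T *m V = 1%:M ->
  frob (U *m diag_mx d *m V^T) (U *m diag_mx d *m V^T)
    = \sum_i d 0 i ^+ 2.
Proof.
move=> UU VV; rewrite -mulmxA frob_mulmxl !mulmxA UU mul1mx frobE.
rewrite mxtrace_mulC trmx_mul trmxK mulmxA -[_ *m V]mulmxA VV mulmx1.
rewrite tr_diag_mx; apply: eq_bigr => i _.
by rewrite mul_diag_mx !mxE eqxx.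
Qed.

Lemma frob_assign (R : realType) p k (f : 'I_p -> 'I_k) (A : 'M[R]_(p, k)) :
  frob (assign_mx f) A = \sum_i A i (f i).
Proof.
apply: eq_bigr => i _; rewrite (bigD1 (f i)) //= mxE eqxx mul1r big1 ?addr0 //.
by move=> j /negPf fij; rewrite mxE eq_sym fij mul0r.
Qed.

Lemma frob_assign_id (R : realType) p k (f : 'I_p -> 'I_k) :
  frob (assign_mx f) (assign_mx f) = p%:R :> R.
Proof.
rewrite frob_assign; under eq_bigr do rewrite mxE eqxx.
by rewrite sumr_const card_ord.
Qed.

Lemma frob_svd_bilinear (R : realType) m n s k (U : 'M[R]_(m, s))
    (V : 'M[R]_(n, s)) (d : 'rV[R]_s) tau
    (X : 'M[R]_(m, k)) (Y : 'M[R]_(n, k)) :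
  U^T *m U = 1%:M -> V^T *m V = 1%:M -> 0 <= tau ->
  (forall i, d 0 i ^+ 2 <= tau) ->
  frob X (U *m diag_mx d *m V^T *m Y) ^+ 2 <= tau * (frob X X * frob Y Y).
Proof.
move=> UU VV tau0 d_le; rewrite -!mulmxA frobC frob_mulmxl.
apply: le_trans (frob_cauchy _ _ _ _ _) _.
have X_le := frob_bessel _ _ _ _ U X UU.
have Y_le := frob_bessel _ _ _ _ V Y VV.
have d_le' := frob_diag_mx _ _ _ d tau (V^T *m Y) d_le.
rewrite mulrCA mulrC; apply: ler_pM; rewrite ?frob_ge0 //.
by apply: le_trans d_le' _; rewrite ler_wpM2l.
Qed.

Section TruncatedSvd.
Context {R : realType} {m n : nat}.
Implicit Types (B : 'M[R]_(m, n)) (F : svd_factors R m n).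

Definition svd_mx F := svd_U F *m diag_mx (svd_S F) *m (svd_V F)^T.

Lemma colsub_orthonormal p s t (w : 'I_t -> 'I_s) (U : 'M[R]_(p, s)) :
  injective w -> U^T *m U = 1%:M -> (colsub w U)^T *m colsub w U = 1%:M.
Proof.
move=> w_inj UU; apply/matrixP => i j.
move/matrixP/(_ (w i) (w j)): UU; rewrite !mxE (inj_eq w_inj) => <-.
by apply: eq_bigr => h _; rewrite !mxE.
Qed.

Lemma frob_sign_matrix B : sign_matrix B -> frob B B = (m * n)%:R.
Proof.
move=> sB; rewrite /frob; under eq_bigr => u _ do
  (under eq_bigr => v _ do
     have -> : B u v * B u v = 1
       by [case: (sB u v) => ->; rewrite ?mulr1 ?mulrNN ?mulr1];
   rewrite sumr_const card_ord).
by rewrite sumr_const card_ord -mulrnA mulnC.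
Qed.

Lemma truncated_svdP r B F : truncated_svd r B F ->
  [/\ (svd_U F)^T *m svd_U F = 1%:M, (svd_V F)^T *m svd_V F = 1%:M,
      (svd_rank F <= r)%N, forall i, svd_S F 0 i ^+ 2 <= frob B B
    & forall k (X : 'M[R]_(m, k)) (Y : 'M[R]_(n, k)),
        frob X ((B - svd_mx F) *m Y) ^+ 2 * r.+1%:R
          <= frob B B * (frob X X * frob Y Y)].
Proof.
case=> G [UU VV Spos Sdec BE] ->.
have normB : frob B B = \sum_i svd_S G 0 i ^+ 2 by rewrite BE frob_svd.
have S_le i : svd_S G 0 i ^+ 2 <= frob B B.
  by rewrite normB (bigD1 i) //= lerDl sumr_ge0 // => j _; rewrite sqr_ge0.
set w := widen_ord (geq_minr r (svd_rank G)).
have w_inj : injective w by move=> i j [ij]; apply: val_inj.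
split; rewrite /= ?colsub_orthonormal ?geq_minl //.
  move=> i.
  by rewrite mxE.
move=> k X Y.
pose d : 'rV_(svd_rank G) :=
  \row_i if (i < minn r (svd_rank G))%N then 0 else svd_S G 0 i.
have -> : B - svd_mx (svd_trunc r G)
    = svd_U G *m diag_mx d *m (svd_V G)^T.
  apply/matrixP => u v; rewrite [in LHS]BE /svd_mx /= !mul_mx_diag !mxE.
  rewrite (bigID (fun i : 'I_(svd_rank G) => (i < minn r (svd_rank G))%N)) /=.
  rewrite (big_ord_narrow (geq_minr r (svd_rank G))) /= addrC addrA.
  rewrite [X in X + _]addrC [X in X + _](_ : _ = 0) ?add0r; last first.
    apply/eqP; rewrite subr_eq0; apply/eqP; apply: eq_bigr => i _.
    by rewrite !mxE.
  rewrite [RHS](bigID (fun i : 'I_(svd_rank G) =>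
    (i < minn r (svd_rank G))%N)) /=.
  rewrite [X in _ = X + _]big1 ?add0r; last first.
    by move=> i i_lt; rewrite !mxE i_lt mulr0 mul0r.
  by apply: eq_bigr => i /negPf i_ge; rewrite !mxE i_ge.
have tail i : d 0 i ^+ 2 <= frob B B / r.+1%:R.
  rewrite mxE; case: ifPn => [_|]; first by rewrite expr0n divr_ge0 ?frob_ge0.
  rewrite leq_min ltn_ord andbT -leqNgt => ri.
  rewrite ler_pdivlMr ?ltr0Sn // normB.
  apply: (@le_trans _ _ (\sum_(j < svd_rank G | (j < r.+1)%N) svd_S G 0 i ^+ 2)).
    rewrite (big_ord_narrow (leq_ltn_trans ri (ltn_ord i))).
    by rewrite sumr_const card_ord mulr_natr.
  rewrite big_mkcond /=; apply: ler_sum => j _; case: ifPn => [jr|_].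
    by rewrite ler_pXn2r ?nnegrE ?(ltW (Spos _)) // Sdec // (leq_trans _ ri).
  by rewrite sqr_ge0.
rewrite -ler_pdivlMr ?ltr0Sn // mulrAC.
by apply: frob_svd_bilinear; rewrite ?divr_ge0 ?frob_ge0.
Qed.

End TruncatedSvd.

Section Solver.
Context {R : realType} {m n k : nat} (F : svd_factors R m n)
  (N : seq 'cV[R]_(svd_rank F))
  (tieX : 'M[R]_(m, k) -> 'I_m -> 'I_k -> bool)
  (tieY : 'M[R]_(n, k) -> 'I_n -> 'I_k -> bool).

Definition net_mx (c : {ffun 'I_k -> 'I_(size N)}) : 'M[R]_(svd_rank F, k) :=
  \matrix_(l, j) (nth 0 N (c j)) l 0.

Lemma solver_roundP c : (0 < k)%N -> exists f g,
  [/\ result (solver_round (row_argmax tieX) (row_argmax tieY) c)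
        = (frob (assign_mx f) (svd_mx F *m assign_mx g),
           (assign_mx f, assign_mx g)),
      forall f', frob (assign_mx f') (svd_U F *m (diag_mx (svd_S F) *m net_mx c))
        <= frob (assign_mx f) (svd_U F *m (diag_mx (svd_S F) *m net_mx c))
    & forall g', frob (assign_mx f) (svd_mx F *m assign_mx g')
        <= frob (assign_mx f) (svd_mx F *m assign_mx g)].
Proof.
move=> k0.
set L := svd_U F *m (diag_mx (svd_S F) *m net_mx c).
have [f fE f_max] := row_argmaxP R m k tieX L k0.
pose Rt := svd_V F *m (diag_mx (svd_S F) *m ((svd_U F)^T *m assign_mx f)).
have [g gE g_max] := row_argmaxP R n k tieY Rt k0.
have RtE Y : frob Rt Y = frob (assign_mx f) (svd_mx F *m Y).
  rewrite frob_mulmxl frob_mulmxl frob_mulmxl trmxK tr_diag_mx.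
  by rewrite /svd_mx !mulmxA.
have max_frob p (h h' : 'I_p -> 'I_k) (A : 'M[R]_(p, k)) :
    (forall i j, A i j <= A i (h i)) ->
    frob (assign_mx h') A <= frob (assign_mx h) A.
  by move=> h_max; rewrite !frob_assign; apply: ler_sum.
exists f, g; split=> [|f'|g'].
- have result_tbind A A' (x : timed A) (h : A -> timed A') :
    result (tbind x h) = result (h (result x)) by [].
  rewrite /solver_round !result_tbind.
  rewrite !(result_tmulmx, result_tdiagmul, result_ttrmx).
  have -> : result (tmx (fun l j => tstep ((nth 0 N (c j)) l 0))) = net_mx c by [].
  by rewrite -/L fE -/Rt gE result_tdot RtE.
- exact: max_frob.
- by rewrite -!RtE ![frob Rt _]frobC; apply: max_frob.
Qed.

Lemma frob_net_error (c : {ffun 'I_k -> 'I_(size N)}) eps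
    (A : 'M[R]_(svd_rank F, k)) :
  (forall j, l2norm (col j A - nth 0 N (c j)) <= eps) ->
  frob (A - net_mx c) (A - net_mx c) <= k%:R * eps ^+ 2.
Proof.
move=> A_near; rewrite /frob exchange_big /= -[X in X%:R * _]card_ord mulr_natl.
rewrite -sumr_const; apply: ler_sum => j _.
have sum_ge0 : 0 <= \sum_i (A i j - (nth 0 N (c j)) i 0) ^+ 2.
  by apply: sumr_ge0 => i _; apply: sqr_ge0.
under eq_bigr => i _ do rewrite !mxE -expr2.
rewrite -(sqr_sqrtr sum_ge0).
rewrite lerXn2r ?nnegrE ?sqrtr_ge0 //.
  by apply: le_trans (A_near j); rewrite sqrtr_ge0.
apply: le_trans (A_near j); rewrite le_eqVlt; apply/orP; left; apply/eqP.
by congr Num.sqrt; apply: eq_bigr => i _; rewrite !mxE.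
Qed.

Lemma bilinear_low_rank_solverP (eps tau e : R) tie :
  (0 < k)%N -> (0 < n)%N -> 0 <= eps -> 0 <= tau -> 0 <= e ->
  ball_net eps N ->
  (svd_U F)^T *m svd_U F = 1%:M -> (svd_V F)^T *m svd_V F = 1%:M ->
  (forall i, svd_S F 0 i ^+ 2 <= tau) ->
  n%:R * (tau * (m%:R * (k%:R * eps ^+ 2))) <= e ^+ 2 ->
  exists (f : 'I_m -> 'I_k) (g : 'I_n -> 'I_k),
    result (bilinear_low_rank_solver N (row_argmax tieX) (row_argmax tieY) tie)
      = Some (assign_mx f, assign_mx g)
    /\ forall (f' : 'I_m -> 'I_k) (g' : 'I_n -> 'I_k),
         frob (assign_mx f') (svd_mx F *m assign_mx g') - 2 * e
         <= frob (assign_mx f) (svd_mx F *m assign_mx g).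
Proof.
move=> k0 n0 eps0 tau0 e0 [N_ball N_net] UU VV S_le e_ge.
have l2E (x : 'cV[R]_(svd_rank F)) : l2norm x = Num.sqrt (frob x x).
  by congr Num.sqrt; apply: eq_bigr => i _; rewrite big_ord1 expr2.
pose rt : R := Num.sqrt n%:R.
have rt0 : 0 < rt by rewrite sqrtr_gt0 ltr0n.
have rt2 : rt ^+ 2 = n%:R by rewrite sqr_sqrtr ?ler0n.
have nearest g' : exists c : {ffun 'I_k -> 'I_(size N)}, forall j,
    l2norm (col j (rt^-1 *: ((svd_V F)^T *m assign_mx g')) - nth 0 N (c j)) <= eps.
  have /choice[c cP] j : exists i : 'I_(size N),
      l2norm (col j (rt^-1 *: ((svd_V F)^T *m assign_mx g')) - nth 0 N i) <= eps.
    set x := col j _.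
    have [|y yN xy] := N_net x; last first.
      move: (yN); rewrite -index_mem => ltN.
      by exists (Ordinal ltN); rewrite /= nth_index.
    have -> : x = rt^-1 *: ((svd_V F)^T *m col j (assign_mx g')).
      apply/matrixP => i i'; rewrite !mxE; congr (_ * _).
      by apply: eq_bigr => v _; rewrite !mxE.
    rewrite l2E -[leRHS]sqrtr1 ler_sqrt ?ltr01 // frobZl frobZr mulrA -invfM.
    rewrite -expr2 rt2 mulrC ler_pdivrMr ?ltr0n // mul1r.
    apply: le_trans (frob_bessel _ _ _ _ _ _ VV) _.
    rewrite /frob -[leRHS](frob_assign_id R n k g') /frob.
    apply: ler_sum => i _; rewrite big_ord1 !mxE (bigD1 j) //= mxE lerDl.
    by apply: sumr_ge0 => ? _; rewrite -expr2 sqr_ge0.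
  by exists (finfun c) => j; rewrite ffunE.
pose rec := [seq result (solver_round (row_argmax tieX) (row_argmax tieY) c)
               | c <- enum {ffun 'I_k -> 'I_(size N)}].
have -> : result (bilinear_low_rank_solver N (row_argmax tieX) (row_argmax tieY) tie)
    = omap snd (result (tscan_max (fun p => tstep p.1) tie rec)).
  by rewrite /rec -result_tmap.
have in_rec (c : {ffun 'I_k -> 'I_(size N)}) :
    result (solver_round (row_argmax tieX) (row_argmax tieY) c) \in rec.
  by apply/mapP; exists c; rewrite ?mem_enum.
have [|b [-> b_rec b_max]] := tscan_maxP R _ (fun p => tstep p.1) tie rec.
  have [c _] := nearest (fun=> Ordinal k0).
  by apply/negP => /eqP rec0; have := in_rec c; rewrite rec0.
move: b_rec => /mapP[c0 _ bE].
have [f [g [roundE _ _]]] := solver_roundP c0 k0.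
rewrite roundE in bE.
exists f, g; split=> [|f' g']; first by rewrite bE.
have [c c_near] := nearest g'.
have [h [h' [hE h_max h'_max]]] := solver_roundP c k0.
have := b_max _ (in_rec c); rewrite hE bE /= => best.
apply: le_trans best; apply: le_trans (h'_max g').
pose D := rt^-1 *: ((svd_V F)^T *m assign_mx g') - net_mx c.
have D_le : frob D D <= k%:R * eps ^+ 2 by apply: frob_net_error.
pose W := svd_U F *m (diag_mx (svd_S F) *m net_mx c).
pose Z := svd_U F *m (diag_mx (svd_S F) *m D).
have split_frob X : frob X (svd_mx F *m assign_mx g')
    = rt * frob X W + rt * frob X Z.
  have VE : (svd_V F)^T *m assign_mx g' = rt *: (net_mx c + D).
    by rewrite addrC subrK scalerA divff ?scale1r // gt_eqF.
  rewrite /svd_mx -!mulmxA VE -!scalemxAr frobZr mulmxDr mulmxDr frobDr mulrDr.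
  by [].
have err (h1 : 'I_m -> 'I_k) : `|rt * frob (assign_mx h1) Z| <= e.
  rewrite -ler_sqr ?nnegrE // -normrX ger0_norm ?sqr_ge0 // exprMn rt2.
  apply: le_trans e_ge; rewrite ler_wpM2l ?ler0n //.
  have -> : Z = svd_U F *m diag_mx (svd_S F) *m (1%:M)^T *m D.
    by rewrite trmx1 mulmx1 -mulmxA.
  apply: (@le_trans _ _ (tau * (frob (assign_mx h1) (assign_mx h1) * frob D D))).
    by apply: frob_svd_bilinear; rewrite ?trmx1 ?mulmx1.
  by rewrite ler_wpM2l // frob_assign_id ler_wpM2l ?ler0n.
have := err h; have := err f'; rewrite !ler_norml => /andP[_ le1] /andP[le2 _].
have le3 : rt * frob (assign_mx f') W <= rt * frob (assign_mx h) W.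
  exact: ler_wpM2l (ltW rt0) _ _ (h_max f').
by rewrite !split_frob; lra.
Qed.

End Solver.

Lemma feasible_assign_mx (R : realType) p k (f : 'I_p -> 'I_k) : (0 < p)%N ->
  feasible (assign_mx f : 'M[R]_(p, k)).
Proof.
move=> p0; split=> [i j|]; first by rewrite mxE; case: eqP; [right|left].
have row1 i : \sum_j `|(assign_mx f : 'M[R]_(p, k)) i j| = 1.
  rewrite (bigD1 (f i)) //= mxE eqxx normr1 big1 ?addr0 // => j /negPf fij.
  by rewrite mxE eq_sym fij normr0.
rewrite /norm_inf1; under eq_bigr => i _ do rewrite row1.
case: p p0 {f row1} => // p _; elim: p => [|p IH].
  by rewrite big_ord_recl big_ord0 /Num.max ltr10.
by rewrite big_ord_recl IH /Num.max ltxx.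
Qed.

Lemma clustering_assign (R : realType) m n k (f : 'I_m -> 'I_k) (g : 'I_n -> 'I_k) :
  let C := clustering_of (assign_mx f : 'M[R]_(m, k)) (assign_mx g) in
  [/\ clustering C, (#|C| <= k)%N
    & forall u v, same_cluster C u v = (f u == g v)].
Proof.
pose h z := match z with inl u => f u | inr v => g v end.
pose cl := cluster_of (assign_mx f : 'M[R]_(m, k)) (assign_mx g).
have in_cluster j z : (z \in cl j) = (h z == j).
  rewrite inE /h; case: z => [u|v]; rewrite mxE; case: (_ == j);
    by rewrite ?eqxx // eq_sym oner_eq0.
set C := clustering_of _ _.
have in_C z : cl (h z) \in C.
  rewrite !inE imset_f // andbT; apply/negP => /eqP /setP/(_ z).
  by rewrite in_cluster inE eqxx.
have C_ex K : K \in C -> exists j, K = cl j.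
  by rewrite !inE => /andP[_ /imsetP[j _ ->]]; exists j.
split=> [||u v].
- rewrite /clustering /finset.partition; apply/and3P; split.
  + apply/eqP/finset.setP => z; rewrite finset.in_setT.
    suff: z \in finset.cover C by move->.
    by apply/finset.bigcupP; exists (cl (h z)); rewrite ?in_cluster.
  + apply/finset.trivIsetP => _ _ /C_ex[i ->] /C_ex[j ->].
    apply: contraNT => /pred0Pn[z /andP[]] /=.
    by rewrite !in_cluster => /eqP-> /eqP->.
  + by rewrite !inE eqxx.
- apply: leq_trans (subset_leq_card (subD1set _ _)) _.
  by apply: leq_trans (leq_imset_card _ _) _; rewrite card_ord.
apply/existsP/eqP => [[K /andP[/C_ex[j ->]]]|fg].
  by rewrite !in_cluster => /andP[/eqP uj /eqP vj]; apply: etrans uj (esym vj).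
by exists (cl (h (inl u)));
  rewrite in_C !in_cluster /= fg !eqxx.
Qed.

Section Agreement.
Context {R : realType} {m n : nat} {B : 'M[R]_(m, n)}.
Hypothesis sB : sign_matrix B.

Definition minus_edges : nat := #|[set e : 'I_m * 'I_n | B e.1 e.2 == -1]%SET|.

Lemma agreeE C :
  (agree B C)%:R = minus_edges%:R
    + \sum_u \sum_v B u v * (same_cluster C u v)%:R :> R.
Proof.
rewrite pair_bigA /= /agree /minus_edges -!sum1_card natrD !natr_sum.
rewrite !(big_mkcond (fun e => e \in _)) -!big_split /=; apply: eq_bigr => -[u v] _.
rewrite !inE /=; have m1 : (1 == -1 :> R) = false by apply/eqP; lra.
by case: (sB u v) => ->; case: same_cluster;
  rewrite ?eqxx ?m1 ?(eq_sym (-1)) ?m1 /=; lra.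
Qed.

Lemma agree_assign k (f : 'I_m -> 'I_k) (g : 'I_n -> 'I_k) :
  (agree B (clustering_of (assign_mx f : 'M[R]_(m, k)) (assign_mx g)))%:R
    = minus_edges%:R + frob (assign_mx f) (B *m assign_mx g) :> R.
Proof.
rewrite agreeE frob_assign; congr (_ + _); apply: eq_bigr => u _.
rewrite mxE; apply: eq_bigr => v _.
have [_ _ ->] := clustering_assign R m n k f g.
by rewrite mxE eq_sym.
Qed.

Lemma optimal_clustering_ge C : (0 < m)%N -> (0 < n)%N ->
  optimal_clustering B C -> (m * n)%:R <= 2 * (agree B C)%:R :> R.
Proof.
move=> m0 n0 [_ C_opt].
pose one : 'I_2 := ord_max.
pose C1 := clustering_of (assign_mx (fun=> ord0 : 'I_2) : 'M[R]_(m, 2))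
  (assign_mx (fun=> ord0 : 'I_2) : 'M[R]_(n, 2)).
pose C2 := clustering_of (assign_mx (fun=> ord0 : 'I_2) : 'M[R]_(m, 2))
  (assign_mx (fun=> one) : 'M[R]_(n, 2)).
have [C1_clust _ same1] := clustering_assign R m n 2 (fun=> ord0) (fun=> ord0).
have [C2_clust _ same2] := clustering_assign R m n 2 (fun=> ord0) (fun=> one).
have all_edges : (agree B C1 + agree B C2 = m * n)%N.
  rewrite -[in RHS](card_ord m) -[in RHS](card_ord n) -card_prod.
  rewrite /agree /C1 /C2 -!sum1_card.
  rewrite !(big_mkcond (fun e => e \in _)) -!big_split /=.
  apply: eq_bigr => -[u v] _; rewrite !inE same1 same2 /=.
  have m1 : (1 == -1 :> R) = false by apply/eqP; lra.
  by case: (sB u v) => ->; rewrite ?eqxx ?m1 ?(eq_sym (-1)) ?m1.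
rewrite -natrM ler_nat -all_edges mul2n -addnn.
by rewrite leq_add // C_opt.
Qed.

End Agreement.

(* A label is kept when it is carried by more than n / (k - 1) vertices of V,
   so at most k - 2 labels are kept; the remaining vertices of U and of V are
   sent to two further clusters that share no edge. *)
Lemma merge_labels (T : finType) m n k (a : 'I_m -> T) (b : 'I_n -> T) :
  (1 < k)%N -> (0 < n)%N ->
  exists (f : 'I_m -> 'I_k) (g : 'I_n -> 'I_k) (Q : {set T}),
    (forall u v, (f u == g v) = (a u == b v) && (a u \in Q))
    /\ forall t, t \notin Q -> (k.-1 * #|[set v | b v == t]%SET| <= n)%N.
Proof.
move=> k1 n0.
pose Q := [set t | (n < k.-1 * #|[set v | b v == t]%SET|)%N]%SET.
have Q_lt : (#|Q| < k.-1)%N.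
  rewrite ltnNge; apply/negP => Q_ge.
  have : (#|Q| * n.+1 <= k.-1 * n)%N.
    rewrite -sum_nat_const.
    apply: (@leq_trans (\sum_(t in Q) k.-1 * #|[set v | b v == t]%SET|)%N).
      by apply: leq_sum => t; rewrite inE.
    rewrite -big_distrr leq_mul2l /=; apply/orP; right.
    rewrite -[leqRHS]card_ord -[leqRHS]sum1_card.
    under eq_bigr => t _ do rewrite -sum1_card big_mkcond.
    rewrite exchange_big; apply: leq_sum => v _ /=.
    under eq_bigr => t _ do rewrite inE.
    rewrite -big_mkcondr /= sum1_card.
    apply: leq_trans (subset_leq_card _) (eq_leq (cards1 (b v))).
    by apply/fintype.subsetP => t /andP[_ /eqP->]; rewrite inE.
  by have := leq_mul Q_ge (leqnn n.+1); nia.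
have lt0 : (k.-2 < k)%N by lia.
have lt1 : (k.-1 < k)%N by lia.
have idx_lt t : t \in Q -> (index t (enum Q) < k.-2)%N.
  by rewrite -mem_enum -index_mem -cardE; lia.
have idx_lt' t : t \in Q -> (index t (enum Q) < k)%N.
  by move=> /idx_lt; lia.
pose lab (d : 'I_k) t : 'I_k :=
  insubd d (if t \in Q then index t (enum Q) else nat_of_ord d).
have labE d t :
    nat_of_ord (lab d t) = if t \in Q then index t (enum Q) else d.
  rewrite val_insubd; case: (boolP (t \in Q)) => tQ; last by rewrite ltn_ord.
  by rewrite idx_lt'.
exists (fun u => lab (Ordinal lt0) (a u)), (fun v => lab (Ordinal lt1) (b v)), Q.
split=> [u v|t]; last by rewrite inE -leqNgt.
rewrite -val_eqE /= !labE /=; case: ifP => aQ; case: ifP => bQ.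
- rewrite andbT; apply/eqP/eqP => [|->//].
  by apply: (index_inj (a u)); rewrite mem_enum.
- rewrite andbT [a u == _](_ : _ = false); last by apply: contraFF bQ => /eqP<-.
  by have := idx_lt _ aQ; lia.
- by rewrite andbF; have := idx_lt _ bQ; lia.
- by rewrite andbF; lia.
Qed.

Lemma agree_k_clusters (R : realType) m n k (B : 'M[R]_(m, n)) C :
  sign_matrix B -> (1 < k)%N -> (0 < n)%N -> clustering C ->
  exists (f : 'I_m -> 'I_k) (g : 'I_n -> 'I_k),
    (agree B C)%:R <= (minus_edges (B := B))%:R
      + frob (assign_mx f) (B *m assign_mx g) + (m * n)%:R / k.-1%:R.
Proof.
move=> sB k1 n0 /and3P[/eqP coverC trivC _].
have in_cover z : z \in finset.cover C by rewrite coverC inE.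
pose a u := finset.pblock C (inl u : 'I_m + 'I_n)%type.
pose b v := finset.pblock C (inr v : 'I_m + 'I_n)%type.
have same u v : same_cluster C u v = (a u == b v).
  apply/existsP/eqP => [[K /andP[KC /andP[uK vK]]]|ab].
    by rewrite /a /b !(finset.def_pblock trivC KC).
  exists (a u); rewrite finset.pblock_mem //=.
  by rewrite {2}ab !finset.mem_pblock !in_cover.
have [f [g [Q [fg Q_small]]]] := merge_labels _ _ _ _ a b k1 n0.
exists f, g; rewrite agreeE // -addrA lerD2l frob_assign.
have k1R : 0 < k.-1%:R :> R by rewrite ltr0n; lia.
have -> : (m * n)%:R / k.-1%:R = \sum_(u < m) (n%:R / k.-1%:R) :> R.
  by rewrite sumr_const card_ord natrM -mulrA mulr_natl.
rewrite -big_split; apply: ler_sum => u _ /=; rewrite mxE.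
rewrite -lerBlDl -sumrB.
apply: (@le_trans _ _ (\sum_v ((a u \notin Q) && (b v == a u))%:R)).
  apply: ler_sum => v _; rewrite same !mxE (eq_sym (g v)) fg (eq_sym (b v)).
  by case: (sB u v) => ->; case: eqP => _; case: (a u \in Q) => /=; lra.
case: (boolP (a u \in Q)) => aQ /=.
  by rewrite big1 // divr_ge0 ?ler0n.
rewrite -natr_sum ler_pdivlMr // -natrM ler_nat mulnC.
apply: leq_trans (Q_small _ aQ); rewrite leq_mul2l; apply/orP; right.
rewrite -sum1_card [leqRHS]big_mkcond /=; apply: leq_sum => v _.
by rewrite inE; case: eqP.
Qed.

Lemma cost_bind A A' (x : timed A) (f : A -> timed A') :
  cost (tbind x f) = (cost x + cost (f (result x)))%N.
Proof. by []. Qed.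

Section SolverCost.
Context {R : realType} {m n k : nat} (F : svd_factors R m n)
  (N : seq 'cV[R]_(svd_rank F))
  (tieX : 'M[R]_(m, k) -> 'I_m -> 'I_k -> bool)
  (tieY : 'M[R]_(n, k) -> 'I_n -> 'I_k -> bool).
Hypotheses (m0 : (0 < m)%N) (n0 : (0 < n)%N) (k0 : (0 < k)%N).

Lemma cost_solver_round (c : {ffun 'I_k -> 'I_(size N)}) :
  (cost (solver_round (row_argmax tieX) (row_argmax tieY) c)
    <= 60 * ((m + n) * (k * (svd_rank F).+1)))%N.
Proof.
move: (row_argmax tieX) (@cost_row_argmax R m k tieX) => PX PX_le.
move: (row_argmax tieY) (@cost_row_argmax R n k tieY) => PY PY_le.
rewrite /solver_round !cost_bind !cost_tmulmx !cost_tdiagmul cost_ttrmx.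
rewrite cost_tdot.
rewrite (cost_tmx _ _ _ 1) // addn0.
set cX := cost (PX _); set cY := cost (PY _).
have cX_le : (cX <= m * (8 * k + 3))%N by apply: PX_le.
have cY_le : (cY <= n * (8 * k + 3))%N by apply: PY_le.
move: cX cY cX_le cY_le; set s := svd_rank F => cX cY cX_le cY_le.
have sk_le : (s * k <= m * (k * s))%N by rewrite [(s * k)%N]mulnC leq_pmull.
have s_le : (s <= s * k)%N by rewrite leq_pmulr.
have m_le : (m <= m * k)%N by rewrite leq_pmulr.
have n_le : (n <= n * k)%N by rewrite leq_pmulr.
have sm_le : (s * m <= m * (k * s))%N.
  by rewrite mulnC leq_mul2l leq_pmull ?orbT.
by lia.
Qed.

Lemma cost_bilinear_low_rank_solver tie :
  (cost (bilinear_low_rank_solver N (row_argmax tieX) (row_argmax tieY) tie)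
    <= size N ^ k * (64 * ((m + n) * (k * (svd_rank F).+1))))%N.
Proof.
set W := ((m + n) * _)%N.
have W0 : (1 < W)%N by rewrite /W; nia.
have N_card : size (enum {ffun 'I_k -> 'I_(size N)}) = (size N ^ k)%N.
  by rewrite -cardE card_ffun !card_ord.
have map_le := cost_tmap _ _ _ _ (enum {ffun 'I_k -> 'I_(size N)})
  cost_solver_round.
rewrite /bilinear_low_rank_solver !cost_bind addn0.
set rec := result (tmap _ _).
have scan_le := cost_tscan_max R _ (fun p => tstep p.1) tie rec (fun=> leqnn 1).
have rec_size : size rec = (size N ^ k)%N.
  by rewrite /rec result_tmap size_map N_card.
apply: leq_trans (leq_add map_le scan_le) _.
rewrite N_card rec_size -mulnDr leq_mul2l; apply/orP; right.
by rewrite -/W; lia.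
Qed.

End SolverCost.

(* 2 sqrt r / epsilon is at most this quantity, which is also a bound for
   the exponent r k of the number of rounds. *)
Definition net_base {R : realType} (delta : R) : R := 2 ^+ 11 * delta ^- 3.

Definition time_exponent {R : realType} (delta : R) : R :=
  ln (net_base delta) / ln 2 * (net_base delta + 2).

Lemma ln2_gt0 (R : realType) : 0 < ln 2 :> R.
Proof. by rewrite ln_gt0 // ltr1n. Qed.

Lemma powR_time_exponent (R : realType) (delta : R) : 0 < delta ->
  2 `^ time_exponent delta = net_base delta `^ (net_base delta + 2).
Proof.
move=> d0; have P0 : 0 < net_base delta.
  by rewrite mulr_gt0 ?exprn_gt0 // invr_gt0 exprn_gt0.
rewrite /time_exponent powRrM; congr (_ `^ _).
rewrite /powR pnatr_eq0 /= divfK ?lnK //.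
by rewrite gt_eqF ?ln2_gt0.
Qed.

Lemma time_exponentO (R : realType) :
  (@time_exponent R) =O_ (at_right 0)
    (fun delta : R => delta ^- 3 * ln (delta ^- 3)).
Proof.
apply/eqO_exP; exists (2 ^+ 16 / ln 2); first by rewrite divr_gt0 ?ln2_gt0.
near=> d.
have d0 : 0 < d by near: d; apply: nbhs_right_gt.
have d_lt : d < 2^-1 by near: d; apply: nbhs_right_lt; rewrite invr_gt0.
set x3 := d ^- 3.
have x3_ge : 8 <= x3.
  have x_ge : 2 <= d^-1 by rewrite -[2]invrK lef_pV2 ?posrE ?invr_gt0 // ltW.
  rewrite /x3 -exprVn (_ : 8 = 2 ^+ 3); last by rewrite -natrX.
  by rewrite lerXn2r ?nnegrE ?invr_ge0 ?(ltW d0).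
have x30 : 0 < x3 by lra.
have ln2_le : ln 2 <= ln x3 by rewrite ler_ln ?posrE //; lra.
have l2 := ln2_gt0 R.
have lnP : ln (net_base d) = ln 2 *+ 11 + ln x3.
  by rewrite /net_base lnM ?posrE // lnXn.
have f0 : 0 <= time_exponent d.
  rewrite /time_exponent lnP mulr_ge0 ?divr_ge0 //; try lra.
  by rewrite /net_base -/x3; lra.
rewrite ger0_norm // ger0_norm; last by rewrite mulr_ge0 //; lra.
have K_eq : 2 ^+ 16 / ln 2 * (x3 * ln x3) = (16 * ln x3 / ln 2) * (2 ^+ 12 * x3).
  by field; rewrite gt_eqF.
rewrite K_eq /time_exponent lnP; apply: ler_pM.
- by rewrite divr_ge0 //; lra.
- by rewrite /net_base -/x3; lra.
- by rewrite ler_pM2r ?invr_gt0 //; lra.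
- by rewrite /net_base -/x3; lra.
Unshelve. all: by end_near.
Qed.

Section ParameterBounds.
Context {R : realType} {delta : R}.
Hypotheses (d0 : 0 < delta) (d1 : delta < 1).

Lemma bcc_k_bounds :
  (bcc_k delta)%:R <= 2 ^+ 3 / delta < (bcc_k delta).+1%:R.
Proof. by apply: truncn_itv; rewrite divr_ge0 ?ltW. Qed.

Lemma bcc_k_gt1 : (1 < bcc_k delta)%N.
Proof.
have /andP[_ k_gt] := bcc_k_bounds.
have : 2 ^+ 3 < (bcc_k delta).+1%:R :> R.
  by apply: le_lt_trans k_gt; rewrite ler_pdivlMr // ler_piMr // ltW.
by rewrite -natrX ltr_nat; lia.
Qed.

Lemma bcc_r_bounds :
  (bcc_r delta)%:R <= 2 ^+ 8 / delta ^+ 2 - 1 < (bcc_r delta).+1%:R.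
Proof.
apply: truncn_itv; rewrite subr_ge0 ler_pdivlMr ?exprn_gt0 // mul1r.
have : delta ^+ 2 <= 1 by rewrite exprn_ile1 ?ltW.
lra.
Qed.

Lemma bcc_eps_gt0 : 0 < bcc_eps delta.
Proof. by rewrite divr_gt0 ?exprn_gt0. Qed.

Lemma solver_rounds_le s N : (s <= bcc_r delta)%N ->
  N%:R <= (2 * Num.sqrt s%:R / bcc_eps delta) ^+ s ->
  (N ^ bcc_k delta * (64 * (bcc_k delta * s.+1)))%:R
    <= net_base delta `^ (net_base delta + 2) * delta ^- 2.
Proof.
move=> sr N_le; have /andP[k_le _] := bcc_k_bounds.
have /andP[r_le _] := bcc_r_bounds.
set P := net_base delta; set k := bcc_k delta in k_le *.
have s_le : s%:R <= 2 ^+ 8 / delta ^+ 2 - 1.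
  by apply: le_trans r_le; rewrite ler_nat.
have P_ge : 2 ^+ 11 <= P.
  rewrite /P /net_base ler_pdivlMr ?exprn_gt0 // ler_piMr ?exprn_ge0 //.
  by rewrite exprn_ile1 ?ltW.
have P_ge1 : 1 <= P by lra.
have P0 : 0 < P by lra.
have base_le : 2 * Num.sqrt s%:R / bcc_eps delta <= P.
  have sqrt_le : Num.sqrt s%:R <= 2 ^+ 4 / delta.
    rewrite -(ler_sqr (x := Num.sqrt _)) ?nnegrE ?sqrtr_ge0 ?divr_ge0 ?(ltW d0) //.
    rewrite sqr_sqrtr ?ler0n // expr_div_n; lra.
  rewrite ler_pdivrMr ?bcc_eps_gt0 //.
  have -> : P * bcc_eps delta = 2 * (2 ^+ 4 / delta).
    by rewrite /P /net_base /bcc_eps; field; rewrite gt_eqF.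
  by rewrite ler_pM2l.
have ks_le : k%:R * (s%:R + 1) <= 2 ^+ 11 / delta ^+ 3.
  have -> : 2 ^+ 11 / delta ^+ 3 = (2 ^+ 3 / delta) * (2 ^+ 8 / delta ^+ 2).
    by field; rewrite gt_eqF.
  by apply: ler_pM => //; lra.
have rounds_le : (N ^ k)%:R <= P `^ P.
  rewrite natrX; apply: (@le_trans _ _ (P ^+ (s * k))).
    rewrite exprM lerXn2r ?nnegrE ?exprn_ge0 ?(ltW P0) //.
    apply: le_trans N_le _; rewrite lerXn2r ?nnegrE ?(ltW P0) //.
    by rewrite divr_ge0 ?mulr_ge0 ?sqrtr_ge0 // ltW // bcc_eps_gt0.
  rewrite -powR_mulrn ?(ltW P0) //; apply: ler_powR => //.
  apply: le_trans ks_le; rewrite mulnC natrM ler_wpM2l //; lra.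
rewrite powRD; last by rewrite (gt_eqF P0) implybT.
rewrite natrM -mulrA; apply: ler_pM; rewrite ?ler0n //.
rewrite natrM natrM -[s.+1%:R]natr1 (powR_mulrn 2 (ltW P0)).
apply: (@le_trans _ _ (P ^+ 2)).
  by rewrite expr2; apply: ler_pM; rewrite ?mulr_ge0 ?addr_ge0 //; lra.
rewrite ler_peMr ?exprn_ge0 ?(ltW P0) // invf_ge1 ?exprn_gt0 //.
by rewrite exprn_ile1 ?ltW.
Qed.


Lemma bcc_k_eps_le :
  (bcc_k delta)%:R * bcc_eps delta ^+ 2 <= delta ^+ 2 / 484.
Proof.
have /andP[k_le _] := bcc_k_bounds.
apply: (@le_trans _ _ (2 ^+ 3 / delta * bcc_eps delta ^+ 2)).
  by rewrite ler_wpM2r ?sqr_ge0.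
have -> : 2 ^+ 3 / delta * bcc_eps delta ^+ 2 = delta ^+ 2 * (delta / 512).
  by rewrite /bcc_eps; field; rewrite gt_eqF.
by rewrite ler_wpM2l ?sqr_ge0 //; have := d1; lra.
Qed.

Lemma bcc_r_ge : 1 <= delta ^+ 2 / 225 * (bcc_r delta).+1%:R.
Proof.
have /andP[_ r_gt] := bcc_r_bounds.
apply: (@le_trans _ _ (delta ^+ 2 / 225 * (2 ^+ 8 / delta ^+ 2 - 1))); last first.
  by rewrite ler_wpM2l ?divr_ge0 ?sqr_ge0 // ltW.
have -> : delta ^+ 2 / 225 * (2 ^+ 8 / delta ^+ 2 - 1)
    = (2 ^+ 8 - delta ^+ 2) / 225 by field; rewrite gt_eqF.
have : delta ^+ 2 <= 1 by rewrite exprn_ile1 ?ltW.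
lra.
Qed.

Lemma bcc_k_pred_ge : (bcc_k delta).-1%:R^-1 <= delta / 6.
Proof.
have /andP[_ k_gt] := bcc_k_bounds; have k1 := bcc_k_gt1.
have k1R : (bcc_k delta).-1%:R = (bcc_k delta)%:R - 1 :> R.
  by rewrite -subn1 natrB // ltnW.
have k0R : 0 < (bcc_k delta).-1%:R :> R by rewrite ltr0n; lia.
rewrite -[leLHS]mul1r ler_pdivrMr // k1R.
have d_lt1 := d1; move: k_gt; rewrite -natr1 ltr_pdivrMr // => k_gt.
by nra.
Qed.

End ParameterBounds.

Section Guarantee.
Context {R : realType} {m n : nat} {delta : R}.
Context {B : 'M[R]_(m, n)} {svd : nat -> timed (svd_factors R m n)}
  {net : forall s : nat, seq 'cV[R]_s}
  {tieX : 'M[R]_(m, bcc_k delta) -> 'I_m -> 'I_(bcc_k delta) -> bool}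
  {tieY : 'M[R]_(n, bcc_k delta) -> 'I_n -> 'I_(bcc_k delta) -> bool}
  {tie : R * ('M[R]_(m, bcc_k delta) * 'M[R]_(n, bcc_k delta)) -> bool}.
Hypotheses (m0 : (0 < m)%N) (n0 : (0 < n)%N) (sB : sign_matrix B)
  (d0 : 0 < delta) (d1 : delta < 1)
  (svdP : truncated_svd (bcc_r delta) B (result (svd (bcc_r delta))))
  (netP : forall s : nat, ball_net (bcc_eps delta) (net s)).

Let run := bcc_procedure delta svd net tieX tieY tie.

Lemma bcc_procedure_agree : exists f g,
  result run = Some (assign_mx f, assign_mx g) /\
  forall Cstar, optimal_clustering B Cstar ->
    (1 - delta) * (agree B Cstar)%:R
      <= (agree B (clustering_of (assign_mx f : 'M[R]_(m, bcc_k delta))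
                     (assign_mx g)))%:R :> R.
Proof.
pose F := result (svd (bcc_r delta)).
have [UU VV _ S_le tail] := truncated_svdP _ _ _ svdP.
rewrite -/F in UU VV S_le tail.
rewrite frob_sign_matrix // in S_le tail.
pose k := bcc_k delta; have k1 : (1 < k)%N := bcc_k_gt1 d0 d1.
pose M : R := (m * n)%:R.
have M0 : 0 <= M by rewrite ler0n.
pose e := M * delta / 22; pose t := M * delta / 15.
have Md0 : 0 <= M * delta by rewrite mulr_ge0 ?(ltW d0).
have e0 : 0 <= e by rewrite /e; lra.
have t0 : 0 <= t by rewrite /t; lra.
have e_ge : n%:R * (M * (m%:R * (k%:R * bcc_eps delta ^+ 2))) <= e ^+ 2.
  have -> : n%:R * (M * (m%:R * (k%:R * bcc_eps delta ^+ 2)))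
      = M ^+ 2 * (k%:R * bcc_eps delta ^+ 2) by rewrite /M natrM; ring.
  have -> : e ^+ 2 = M ^+ 2 * (delta ^+ 2 / 484) by rewrite /e; field.
  by rewrite ler_wpM2l ?exprn_ge0 // bcc_k_eps_le.
have [f [g [solverE best]]] := bilinear_low_rank_solverP F (net (svd_rank F)) tieX tieY
  _ _ _ tie (ltnW k1) n0 (ltW (bcc_eps_gt0 d0)) M0 e0 (netP _) UU VV S_le e_ge.
exists f, g; split=> [|Cstar C_opt]; first exact: solverE.
have approx (f' : 'I_m -> 'I_k) (g' : 'I_n -> 'I_k) :
    `|frob (assign_mx f') (B *m assign_mx g')
      - frob (assign_mx f') (svd_mx F *m assign_mx g')| <= t.
  have -> : frob (assign_mx f') (B *m assign_mx g')
      - frob (assign_mx f') (svd_mx F *m assign_mx g')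
      = frob (assign_mx f') ((B - svd_mx F) *m assign_mx g').
    by apply/eqP; rewrite subr_eq -frobDr -mulmxDl subrK.
  rewrite -ler_sqr ?nnegrE // -normrX ger0_norm ?sqr_ge0 //.
  have := tail _ (assign_mx f') (assign_mx g').
  rewrite !frob_assign_id -natrM -/M -expr2 => tail_le.
  have r0 : 0 < (bcc_r delta).+1%:R :> R by rewrite ltr0n.
  rewrite -(ler_pM2r r0); apply: le_trans tail_le _.
  have -> : t ^+ 2 = M ^+ 2 * (delta ^+ 2 / 225) by rewrite /t; field.
  by rewrite -mulrA ler_peMr ?sqr_ge0 // bcc_r_ge.
have [f' [g' C_le]] := agree_k_clusters _ _ _ k _ _ sB k1 n0 C_opt.1.
rewrite agree_assign //.
have merge_le : M / k.-1%:R <= M * delta / 6.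
  by rewrite -mulrA ler_wpM2l // bcc_k_pred_ge.
have := optimal_clustering_ge sB _ m0 n0 C_opt; rewrite -/M => half.
have := best f' g'.
have := approx f' g'; have := approx f g; rewrite !ler_norml.
move=> /andP[fg_ge _] /andP[_ fg'_le] fg_best.
have loss : delta * M <= delta * (2 * (agree B Cstar)%:R).
  by rewrite ler_wpM2l ?(ltW d0).
rewrite /e /t in fg_ge fg'_le fg_best.
rewrite -/M in C_le; lra.
Qed.

Lemma bcc_procedure_cost :
  (forall s : nat,
     (size (net s))%:R <= (2 * Num.sqrt s%:R / bcc_eps delta) ^+ s) ->
  (cost run)%:R <= 2 `^ time_exponent delta * delta ^- 2 * (m + n)%:R
                   + (cost (svd (bcc_r delta)))%:R.
Proof.
move=> net_le; rewrite /run /bcc_procedure cost_bind natrD addrC lerD2r.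
set F := result (svd _).
have [_ _ s_le _ _] := truncated_svdP _ _ _ svdP.
have := cost_bilinear_low_rank_solver F (net (svd_rank F)) tieX tieY m0 n0
  (ltnW (bcc_k_gt1 d0 d1)) tie.
rewrite -(ler_nat R) => /le_trans; apply.
rewrite powR_time_exponent //.
apply: le_trans (ler_wpM2r (ler0n _ _) (solver_rounds_le d0 d1 _ _ s_le (net_le _))).
by rewrite -natrM ler_nat; apply: eq_leq; ring.
Qed.

End Guarantee.
Theorem theorem2 (R : realType) :
  exists f : R -> R,
    f =O_ (at_right 0) (fun delta : R => delta ^- 3 * ln (delta ^- 3)) /\
    forall (m n : nat) (B : 'M[R]_(m, n)) (delta : R)
      (svd : nat -> timed (svd_factors R m n))
      (net : forall s : nat, seq 'cV[R]_s)
      (tieX : 'M[R]_(m, bcc_k delta) -> 'I_m -> 'I_(bcc_k delta) -> bool)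
      (tieY : 'M[R]_(n, bcc_k delta) -> 'I_n -> 'I_(bcc_k delta) -> bool)
      (tie : R * ('M[R]_(m, bcc_k delta) * 'M[R]_(n, bcc_k delta)) -> bool),
      (0 < m)%N -> (0 < n)%N -> sign_matrix B -> 0 < delta -> delta < 1 ->
      (forall r : nat, truncated_svd r B (result (svd r))) ->
      (forall s : nat, ball_net (bcc_eps delta) (net s) /\
         (size (net s))%:R <= (2 * Num.sqrt s%:R / bcc_eps delta) ^+ s) ->
      let run := bcc_procedure delta svd net tieX tieY tie in
      (exists (X : 'M[R]_(m, bcc_k delta)) (Y : 'M[R]_(n, bcc_k delta)),
         [/\ result run = Some (X, Y),
             feasible X /\ feasible Y,
             clustering (clustering_of X Y),
             (#|clustering_of X Y|)%:R <= 2 ^+ 3 / delta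
           & forall Cstar, optimal_clustering B Cstar ->
               (agree B (clustering_of X Y))%:R
                 >= (1 - delta) * (agree B Cstar)%:R]) /\
      (cost run)%:R
        <= 2 `^ f delta * delta ^- 2 * (m + n)%:R
           + (cost (svd (bcc_r delta)))%:R.
Proof.
exists time_exponent; split; first exact: time_exponentO.
move=> m n B delta svd net tieX tieY tie m0 n0 sB d0 d1 svdP netP run.
split; last first.
  by apply: bcc_procedure_cost => // s; case: (netP s).
have [f [g [runE agree_ge]]] :=
  bcc_procedure_agree (tieX := tieX) (tieY := tieY) (tie := tie)
    m0 n0 sB d0 d1 (svdP _) (fun s => (netP s).1).
have [clust card_le _] := clustering_assign R m n _ f g.
exists (assign_mx f), (assign_mx g); split=> //.
- by split; apply: feasible_assign_mx.
- have /andP[k_le _] := bcc_k_bounds d0.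
  by apply: le_trans k_le; rewrite ler_nat.
Qed.
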